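(* Every annulus of $K$ is semidefinite-representable. If the residue field of $K$ is infinite, then no non-trivial (i.e. non-empty) annulus of $K$ is a spectrahedron in $K$.
   Context: $(K,\mathrm{val})$ is a complete discretely valued field: $\mathrm{val}: K \to \mathbb{Z}\cup\{+\infty\}$ is a surjective valuation and $K$ is complete for the induced metric; $\mathrm{val}$ denotes also its extension to an algebraic closure of $K$. The valuation ring is $\mathcal{O}_K=\{x\in K:\mathrm{val}(x)\ge 0\}$ and the residue field is $\mathcal{O}_K/\{x\in K:\mathrm{val}(x)>0\}$. An annulus of $K$ is a set $\{x\in K : a\le \mathrm{val}(x)\le b\}$ with $a,b$ positive real numbers. A matrix $M\in K^{d\times d}$ is positive semidefinite, written $M\succeq 0$, if all its eigenvalues in an algebraic closure of $K$ have nonnegative valuation (no symmetry is required). A spectrahedron in $K^n$ is any affine section (intersection with an affine subspace of $K^n$, possibly all of $K^n$) of a set of the form $\{x\in K^n : A_0+x_1A_1+\cdots+x_nA_n\succeq 0\}$ for some $d\in\mathbb{N}$ and $A_0,\dots,A_n\in K^{d\times d}$. A set $\mathcal{R}\subset K^n$ is semidefinite-representable if there exist $m,d\in\mathbb{N}$ and matrices $A_0,\dots,A_n,B_1,\dots,B_m\in K^{d\times d}$ such that $\mathcal{R}=\{x\in K^n : \exists\, y\in K^m,\ A_0+\sum_{i=1}^n x_iA_i+\sum_{j=1}^m y_jB_j\succeq 0\}$. For both notions, subsets of $K$ correspond to $n=1$. *)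

(* Defs.v *)
From HB Require Import structures.
From mathcomp Require Import all_boot all_order all_algebra.
From mathcomp Require Import all_classical all_reals.

Set Implicit Arguments.
Unset Strict Implicit.
Unset Printing Implicit Defensive.

Import Order.TTheory GRing.Theory Num.Theory.
Local Open Scope classical_set_scope.
Local Open Scope ring_scope.

(* The value group lies in G; [\bar G] also contains -oo, which is excluded
   as a value. *)
Record is_valuation (G : realDomainType) (F : fieldType) (v : F -> \bar G)
    : Prop := IsValuation {
  valuation_neqNy : forall x, v x <> -oo%E ;
  valuation_eqy : forall x, v x = +oo%E <-> x = 0 ;
  valuationM : forall x y, v (x * y) = (v x + v y)%E ;
  valuationD : forall x y, (Order.min (v x) (v y) <= v (x + y)%R)%E
}.

(* The metric induced by v, normalised as d(x, y) = 2 ^ (- v (x - y)). *)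
Definition val_dist (R : realType) (K : fieldType) (v : K -> \bar int)
    (x y : K) : R :=
  if v (x - y) is z%:E then 2 ^ (- z) else 0.

Definition val_cauchy (R : realType) (K : fieldType) (v : K -> \bar int)
    (u : nat -> K) : Prop :=
  forall e : R, 0 < e -> exists N : nat, forall m n : nat,
    (N <= m)%N -> (N <= n)%N -> val_dist R v (u m) (u n) < e.

Definition val_converges (R : realType) (K : fieldType) (v : K -> \bar int)
    (u : nat -> K) (l : K) : Prop :=
  forall e : R, 0 < e -> exists N : nat, forall n : nat,
    (N <= n)%N -> val_dist R v (u n) l < e.

Definition val_complete (R : realType) (K : fieldType) (v : K -> \bar int)
    : Prop :=
  forall u : nat -> K, val_cauchy R v u -> exists l, val_converges R v u l.

Record complete_discretely_valued (R : realType) (K : fieldType)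
    (v : K -> \bar int) : Prop := CompleteDiscretelyValued {
  cdv_valuation : is_valuation v ;
  cdv_surjective : forall z : \bar int, z <> -oo%E -> exists x, v x = z ;
  cdv_complete : val_complete R v
}.

(* The inclusion of Z u {+oo} in R u {+oo}. *)
Definition int_to_ereal (R : realType) : \bar int -> \bar R :=
  er_map (fun z : int => z%:~R).

Definition is_algebraic_closure (K : fieldType) (L : closedFieldType)
    (iota : {rmorphism K -> L}) : Prop :=
  forall z : L, algebraicOver iota z.

Definition extends_valuation (R : realType) (K : fieldType)
    (v : K -> \bar int) (L : fieldType) (iota : {rmorphism K -> L})
    (w : L -> \bar R) : Prop :=
  is_valuation w /\ forall x : K, w (iota x) = int_to_ereal R (v x).

Definition valuation_ring (K : fieldType) (v : K -> \bar int) : set K :=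
  [set x | (0 <= v x)%E].

Definition maximal_ideal (K : fieldType) (v : K -> \bar int) : set K :=
  [set x | (0 < v x)%E].

(* The underlying set of the quotient: the cosets x + m, for x integral. *)
Definition residue_field (K : fieldType) (v : K -> \bar int) : set (set K) :=
  [set [set x + t | t in maximal_ideal v] | x in valuation_ring v].

Definition is_annulus (R : realType) (K : fieldType) (v : K -> \bar int)
    (A : set K) : Prop :=
  exists a b : R, [/\ 0 < a, 0 < b &
    A = [set x | (a%:E <= int_to_ereal R (v x))%E /\
                 (int_to_ereal R (v x) <= b%:E)%E]].

Definition psdmx (R : realType) (K : fieldType) (L : closedFieldType)
    (iota : {rmorphism K -> L}) (w : L -> \bar R) (d : nat) (M : 'M[K]_d)
    : Prop :=
  forall l : L, eigenvalue (map_mx iota M) l -> (0 <= w l)%E.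

Definition affine_subspace (K : fieldType) (n : nat) (E : set 'rV[K]_n)
    : Prop :=
  exists (p : 'rV[K]_n) (U : {vspace 'rV[K]_n}),
    E = [set x : 'rV[K]_n | x - p \in U].

Definition spectrahedron (R : realType) (K : fieldType) (L : closedFieldType)
    (iota : {rmorphism K -> L}) (w : L -> \bar R) (n : nat)
    (S : set 'rV[K]_n) : Prop :=
  exists (d : nat) (A0 : 'M[K]_d) (A : 'I_n -> 'M[K]_d) (E : set 'rV[K]_n),
    affine_subspace E /\
    S = [set x : 'rV[K]_n | psdmx iota w (A0 + \sum_(i < n) x 0 i *: A i)]
          `&` E.

Definition semidefinite_representable (R : realType) (K : fieldType)
    (L : closedFieldType) (iota : {rmorphism K -> L}) (w : L -> \bar R)
    (n : nat) (S : set 'rV[K]_n) : Prop :=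
  exists (m d : nat) (A0 : 'M[K]_d) (A : 'I_n -> 'M[K]_d)
         (B : 'I_m -> 'M[K]_d),
    S = [set x : 'rV[K]_n | exists y : 'rV[K]_m,
           psdmx iota w (A0 + \sum_(i < n) x 0 i *: A i
                            + \sum_(j < m) y 0 j *: B j)].

(* The identification of K with K^1. *)
Definition line_set (K : fieldType) (A : set K) : set 'rV[K]_1 :=
  [set x : 'rV[K]_1 | A (x 0 0)].

(* Main.v *)
Require Import Defs.
From mathcomp Require Import all_boot all_order all_algebra.
From mathcomp Require Import all_classical all_reals.
From mathcomp Require Import ring zify.

Set Implicit Arguments.
Unset Strict Implicit.
Unset Printing Implicit Defensive.

Import Order.TTheory GRing.Theory Num.Theory.
Local Open Scope classical_set_scope.
Local Open Scope ring_scope.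

(** Both halves rest on [psdmx_char_poly]: a matrix over [K] is positive
    semidefinite exactly when its characteristic polynomial has integral
    coefficients. Indeed elementary symmetric functions of integral elements
    are integral, and a root of a monic polynomial with integral coefficients
    is integral. Positivity is thus integrality of some polynomials in the
    entries.

    An annulus is a set [m <= v x <= n] with [m], [n] integers. The lower
    bound is integrality of [x / p], where [v p = m]. The upper bound says
    that [q / x] is integral, where [v q = n]; this is not polynomial in [x],
    but an auxiliary integral variable [y] with [x * y] close to [q] can stand
    for [q / x]. It suffices that [q^-1 * x * y - 1] have positive valuation,
    as [q^-1 * x * y] is then a unit ([valuation_le_lift]). This bilinear
    condition is the integrality of the determinant of a traceless 2 x 2
    matrix affine in [x] and [y], and a block diagonal matrix collects the
    three conditions.

    Conversely, let an annulus through [x0] be a spectrahedron. It contains [t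
    * x0] for all units [t], so each coefficient of the characteristic
    polynomial of the pencil at [t * x0] is a polynomial in [t] that takes
    integral values at all units. If the residue field is infinite there are
    as many units with pairwise distinct residues as interpolation requires,
    and Lagrange's formula on such nodes has integral weights
    ([integral_horner_interp]). So these polynomials are integral at [t = 0]
    too, that is, the pencil is positive semidefinite at the origin. The
    affine subspace contains two distinct multiples of [x0], hence the origin
    as well; but the origin has infinite valuation and lies in no annulus. *)

(** * Valuations on a field *)

Section Valuation.
Variables (G : realDomainType) (F : fieldType) (v : F -> \bar G).
Hypothesis hv : is_valuation v.
Implicit Types x y : F.

Lemma valuation0 : v 0 = +oo%E.
Proof. exact/(valuation_eqy hv). Qed.

Lemma valuation_fin_num x : x != 0 -> v x \is a fin_num.
Proof.
move=> x0; rewrite fin_numE; apply/andP; split; apply/eqP.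
  exact: @valuation_neqNy _ _ _ hv x.
by move/(valuation_eqy hv)/eqP; apply/negP.
Qed.

Lemma valuation1 : v 1 = 0%E.
Proof.
have := valuationM hv 1 1; rewrite mulr1.
have /fineK <- := valuation_fin_num (oner_neq0 F).
rewrite -EFinD => -[] /eqP; rewrite -subr_eq0 opprD addNKr oppr_eq0.
by move=> /eqP ->.
Qed.

Lemma valuationN1 : v (- 1) = 0%E.
Proof.
have := valuationM hv (- 1) (- 1); rewrite mulrNN mulr1 valuation1.
have /fineK <- : v (- 1) \is a fin_num.
  by apply: valuation_fin_num; rewrite oppr_eq0 oner_neq0.
rewrite -EFinD => -[] /esym/eqP; rewrite -mulr2n mulrn_eq0 /=.
by move=> /eqP ->.
Qed.

Lemma valuationN x : v (- x) = v x.
Proof. by rewrite -mulN1r (valuationM hv) valuationN1 add0e. Qed.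

Lemma valuationV x : x != 0 -> v x^-1 = (- v x)%E.
Proof.
move=> x0; have fx := valuation_fin_num x0.
have /fineK fy : v x^-1 \is a fin_num by rewrite valuation_fin_num ?invr_eq0.
have := valuationM hv x x^-1; rewrite mulfV// valuation1 -(fineK fx) -fy.
rewrite -EFinD -EFinN => -[] /esym/eqP.
by rewrite addrC addr_eq0 => /eqP ->.
Qed.

Lemma integralM x y : (0 <= v x -> 0 <= v y -> 0 <= v (x * y)%R)%E.
Proof. by rewrite (valuationM hv); exact: adde_ge0. Qed.

Lemma integralD x y : (0 <= v x -> 0 <= v y -> 0 <= v (x + y)%R)%E.
Proof.
move=> hx hy; apply: le_trans (valuationD hv x y).
by rewrite le_min hx hy.
Qed.

Lemma integralB x y : (0 <= v x -> 0 <= v y -> 0 <= v (x - y)%R)%E.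
Proof. by move=> hx hy; apply: integralD; rewrite ?valuationN. Qed.

Lemma integralX x n : (0 <= v x -> 0 <= v (x ^+ n)%R)%E.
Proof.
move=> hx; elim: n => [|n IH]; first by rewrite expr0 valuation1.
by rewrite exprS; exact: integralM.
Qed.

(** Dividing the equation [p(z) = 0] by [z ^ (deg p - 1)] writes [z] as a
    combination of powers of [z^-1]; were [z] not integral, [z^-1] would be. *)
Lemma integral_root_monic (p : {poly F}) (z : F) :
  p \is monic -> (forall i, 0 <= v p`_i)%E -> root p z -> (0 <= v z)%E.
Proof.
move=> /monicP pm pint /rootP pz; rewrite leNgt; apply/negP => z_neg.
have z0 : z != 0.
  by apply: contraTneq z_neg => ->; rewrite valuation0 -leNgt leey.
have zV : (0 <= v z^-1)%E by rewrite valuationV// oppe_ge0 ltW.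
move: pm pz; rewrite /lead_coef horner_coef.
move sz : (size p) => k; case: k sz => [|[|n]] /= sz.
- by rewrite nth_default ?sz// => /esym/eqP; rewrite oner_eq0.
- by move=> p1; rewrite big_ord1 p1 mul1r expr0 => /eqP; rewrite oner_eq0.
move=> p1; rewrite big_ord_recr/= p1 mul1r => /eqP.
rewrite addrC addr_eq0 => /eqP pz.
have zE : z = - \sum_(i < n.+1) p`_i * z^-1 ^+ (n - i).
  rewrite -[LHS](mulfK (expf_neq0 n z0)) -exprS pz mulNr big_distrl/=.
  congr (- _); apply: eq_bigr => i _; rewrite -mulrA; congr (_ * _).
  have -> : z ^+ n = z ^+ (n - i) * z ^+ i by rewrite -exprD subnK ?leq_ord.
  by rewrite invfM mulrCA mulfV ?expf_neq0// mulr1 exprVn.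
move: z_neg; apply/negP; rewrite -leNgt zE valuationN.
apply: (big_ind (fun x => (0 <= v x)%E)) => [||i _].
- by rewrite valuation0 leey.
- exact: integralD.
- by apply: integralM => //; exact: integralX.
Qed.

Lemma integral_coef_prod_XsubC (r : seq F) :
  {in r, forall z, 0 <= v z}%E ->
  forall i, (0 <= v (\prod_(z <- r) ('X - z%:P))`_i)%E.
Proof.
elim: r => [_ i|z r IH rint i].
  by rewrite big_nil coefC; case: ifP; rewrite ?valuation1 ?valuation0 ?leey.
have {}IH : forall i, (0 <= v (\prod_(z <- r) ('X - z%:P))`_i)%E.
  by apply: IH => y yr; apply: rint; rewrite inE yr orbT.
rewrite big_cons mulrBl coefB coefXM coefCM; apply: integralB.
  by case: ifP => // _; rewrite valuation0 leey.
by apply: integralM => //; apply: rint; rewrite mem_head.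
Qed.

(** This is integrality of the Lagrange interpolation formula: its
    denominators are products of differences of nodes, which are units. The
    induction peels off one node by Euclidean division by [X - t]. *)
Lemma integral_horner_interp (s : seq F) (f : {poly F}) (z : F) :
  (size f <= size s)%N ->
  {in s, forall t, 0 <= v t}%E ->
  pairwise (fun t t' => v (t' - t) == 0%E) s ->
  {in s, forall t, 0 <= v f.[t]}%E ->
  (0 <= v z)%E -> (0 <= v f.[z])%E.
Proof.
move=> + + + + zint; elim: s f => [|t s IH] f /=.
  rewrite leqn0 size_poly_eq0 => /eqP -> _ _ _.
  by rewrite horner0 valuation0 leey.
move=> fs sint /andP[/allP ts s_sep] fint.
have tint : (0 <= v t)%E by apply: sint; rewrite mem_head.
have ftint : (0 <= v f.[t])%E by apply: fint; rewrite mem_head.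
have /factor_theorem[g fE] : root (f - f.[t]%:P) t.
  by rewrite /root !hornerE subrr.
have fgE y : f.[y] = g.[y] * (y - t) + f.[t].
  have := congr1 (fun h => h.[y]) fE; rewrite !hornerE => /eqP.
  by rewrite subr_eq => /eqP.
rewrite fgE; apply: integralD => //; apply: integralM; last exact: integralB.
apply: IH => //.
- have [->|g0] := eqVneq g 0; first by rewrite size_poly0.
  have : (size (f - f.[t]%:P)%R <= (size s).+1)%N.
    rewrite (leq_trans (size_polyD _ _))// geq_max fs size_polyN.
    by rewrite (leq_trans (size_polyC_leq1 _)).
  by rewrite fE size_Mmonic ?monicXsubC// size_XsubC addn2.
- by move=> y ys; apply: sint; rewrite inE ys orbT.
move=> y ys; have := ts y ys => /eqP yt.
have : (0 <= v (f.[y] - f.[t])%R)%E.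
  by apply: integralB => //; apply: fint; rewrite inE ys orbT.
by rewrite fgE addrK (valuationM hv) yt adde0.
Qed.

End Valuation.

(** * Positive semidefinite matrices *)

Section Psd.
Variables (R : realType) (K : fieldType) (v : K -> \bar int).
Variables (L : closedFieldType) (iota : {rmorphism K -> L}) (w : L -> \bar R).
Hypotheses (hv : is_valuation v) (hw : extends_valuation v iota w).

Lemma extends_valuation_ge0 x : (0 <= w (iota x))%E = (0 <= v x)%E.
Proof.
rewrite hw.2 /int_to_ereal; case: (v x) => [z||] //=.
  by rewrite !lee_fin ler0z.
by rewrite !leey.
Qed.

(** The characteristic polynomial splits over [L], so its coefficients are
    polynomials in the eigenvalues, which are themselves roots of it. This turns
    a condition on elements of [L] into one on polynomial functions of the
    entries, with values in [K]. *)
Lemma psdmx_char_poly d (M : 'M[K]_d) :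
  psdmx iota w M <-> forall i, (0 <= v (char_poly M)`_i)%E.
Proof.
split=> [psdM i|intM l]; last first.
  rewrite eigenvalue_root_char -map_char_poly.
  apply: (integral_root_monic hw.1).
    by rewrite map_monic char_poly_monic.
  by move=> i; rewrite coef_map extends_valuation_ge0.
rewrite -extends_valuation_ge0 -coef_map map_char_poly.
have [r rE] := closed_field_poly_normal (char_poly (map_mx iota M)).
rewrite (monicP (char_poly_monic _)) scale1r in rE.
rewrite rE; apply: (integral_coef_prod_XsubC hw.1) => z zr; apply: psdM.
by rewrite eigenvalue_root_char rE root_prod_XsubC.
Qed.

Lemma psdmx_scalar1 (x : K) : psdmx iota w (x%:M : 'M_1) <-> (0 <= v x)%E.
Proof.
rewrite psdmx_char_poly; split=> [/(_ 0)|xint i].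
  by rewrite char_poly_det det_scalar expr1 mulN1r valuationN.
rewrite char_poly_trig ?scalar_mx_is_trig// big_ord1 mxE eqxx mulr1n.
rewrite coefB coefX coefC; apply: (integralB hv).
  by case: eqP => _; rewrite ?(valuation1 hv) ?(valuation0 hv) ?leey.
by case: eqP => _ //; rewrite (valuation0 hv) leey.
Qed.

Lemma psdmx2 (M : 'M[K]_2) :
  psdmx iota w M <-> (0 <= v (\tr M))%E /\ (0 <= v (\det M))%E.
Proof.
have c0 : (char_poly M)`_0 = \det M by rewrite char_poly_det sqrrN expr1n mul1r.
have c1 : (char_poly M)`_1 = - \tr M by rewrite -char_poly_trace.
rewrite psdmx_char_poly; split=> [intM|[trM detM] [|[|[|i]]]].
- by rewrite -c0 -(valuationN hv (\tr M)) -c1.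
- by rewrite c0.
- by rewrite c1 valuationN.
- have := char_poly_monic M; rewrite monicE /lead_coef size_char_poly.
  by move=> /eqP ->; rewrite (valuation1 hv).
- by rewrite nth_default ?size_char_poly// (valuation0 hv) leey.
Qed.

Lemma psdmx_block_diag m n (A : 'M[K]_m) (B : 'M[K]_n) :
  psdmx iota w (block_mx A 0 0 B) <-> psdmx iota w A /\ psdmx iota w B.
Proof.
have E l : eigenvalue (map_mx iota (block_mx A 0 0 B)) l
    = eigenvalue (map_mx iota A) l || eigenvalue (map_mx iota B) l.
  rewrite !eigenvalue_root_char map_block_mx !map_mx0 -rootM.
  by rewrite {1}/char_poly char_block_diag_mx det_ublock.
split=> [psdAB|[psdA psdB] l].
  by split=> l eig; apply: psdAB; rewrite E eig ?orbT.
by rewrite E => /orP[/psdA|/psdB].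
Qed.

End Psd.

(** * Units with distinct residues *)

Section Residues.
Variables (K : fieldType) (v : K -> \bar int).
Hypotheses (hv : is_valuation v) (res_inf : infinite_set (residue_field v)).

(** Otherwise every residue class would be that of an entry of [s]. *)
Lemma exists_new_residue (s : seq K) :
  exists2 t, (0 <= v t)%E & {in s, forall x, ~~ (0 < v (t - x)%R)%E}.
Proof.
apply: contrapT => no_t; apply: res_inf.
pose coset x : set K := [set x + u | u in maximal_ideal v].
apply: (@sub_finite_set _ _ (coset @` [set` s])); last first.
  exact/finite_image/finite_seq.
move=> _ [t tint <-].
have [x [xs tx]] : exists x, x \in s /\ (0 < v (t - x)%R)%E.
  apply: contrapT => no_x; apply: no_t; exists t => // x xs.
  by apply/negP => tx; apply: no_x; exists x.
exists x => //; have max_subr a b : (0 < v (a - b)%R)%E ->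
    coset a `<=` coset b.
  move=> ab _ [u um <-]; exists (a - b + u); last by rewrite addrA subrKC.
  apply: lt_le_trans (valuationD hv _ _); rewrite lt_min ab; exact: um.
apply/seteqP; split; apply: max_subr => //.
by rewrite -opprB (valuationN hv).
Qed.

Lemma exists_units_distinct_residues (n : nat) :
  exists2 s : seq K, size s = n &
    {in s, forall t, v t = 0%E} /\
    pairwise (fun t t' => v (t' - t) == 0%E) s.
Proof.
elim: n => [|n [s sn [s_unit s_sep]]]; first by exists [::].
(* A residue different from that of 0 is the residue of a unit. *)
have [t tint t_new] := exists_new_residue (0 :: s).
have vt : v t = 0%E.
  apply/eqP; rewrite eq_le tint andbT leNgt -[t in v t]subr0.
  by apply: t_new; rewrite mem_head.
exists (t :: s); first by rewrite /= sn.
split=> [x|/=].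
  by rewrite inE => /predU1P[->//|/s_unit].
rewrite s_sep andbT; apply/allP => x xs; rewrite -(valuationN hv) opprB.
rewrite eq_le leNgt t_new ?inE ?xs ?orbT//=.
by apply: (integralB hv) => //; rewrite s_unit.
Qed.

(** Interpolation at units of pairwise distinct residues: over an infinite
    residue field there are enough of them for any degree. *)
Lemma integral_horner0 (f : {poly K}) :
  (forall t, v t = 0%E -> (0 <= v f.[t])%E) -> (0 <= v f.[0])%E.
Proof.
move=> fint.
have [s sn [s_unit s_sep]] := exists_units_distinct_residues (size f).
apply: (integral_horner_interp hv (s := s)) => //.
- by rewrite sn.
- by move=> t /s_unit ->.
- by move=> t /s_unit /fint.
- by rewrite (valuation0 hv) leey.
Qed.

End Residues.

(** * Annuli *)

Section Annulus.
Variables (R : realType) (K : fieldType) (v : K -> \bar int).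
Variables (L : closedFieldType) (iota : {rmorphism K -> L}) (w : L -> \bar R).
Hypotheses (hv : is_valuation v) (hw : extends_valuation v iota w).

(** The coefficients of the characteristic polynomial of a pencil are
    polynomials in its parameter, to which [integral_horner0] applies. *)
Lemma psdmx_pencil0 d (A B : 'M[K]_d) :
  infinite_set (residue_field v) ->
  (forall t, v t = 0%E -> psdmx iota w (A + t *: B)) -> psdmx iota w A.
Proof.
move=> res_inf psd; apply/(psdmx_char_poly hw) => i.
pose P := char_poly (map_mx polyC A + 'X *: map_mx polyC B).
have PE t : (P`_i).[t] = (char_poly (A + t *: B))`_i.
  rewrite -[LHS]/(horner_eval t P`_i) -coef_map map_char_poly.
  congr ((char_poly _)`_i).
  by apply/matrixP => j k; rewrite !mxE /= /horner_eval !hornerE.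
rewrite -[A]addr0 -(scale0r B) -PE.
apply: (integral_horner0 hv res_inf) => t vt.
by rewrite PE; exact: ((psdmx_char_poly hw _).1 (psd t vt) i).
Qed.

Lemma annulusE (A : set K) : is_annulus R v A ->
  exists m n : int, forall x, A x <-> (m%:E <= v x <= n%:E)%E.
Proof.
move=> [a [b [_ _ ->]]]; exists (Num.ceil a), (Num.floor b) => x /=.
have := @valuation_neqNy _ _ _ hv x; rewrite /int_to_ereal.
case: (v x) => [z||] //= _; last by rewrite !leey; split => [[]|/andP[]].
by rewrite !lee_fin ceil_le_int floor_ge_int; split=> [[-> ->]|/andP[-> ->]].
Qed.

(** An element congruent to [1] modulo the maximal ideal is a unit, so
    [q^-1 * x * y] is one and [v x = n - v y]. Here [v (r ^+ 2) = - 2] expresses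
    congruence as integrality, a square being what a 2 x 2 determinant can
    produce. The exact equation [x * y = q], solved by [y = q / x], is not a
    positivity condition on [x] and [y]. *)
Lemma valuation_le_lift (q r x : K) (n : int) :
  v q = n%:E -> v r = (- 1)%:E ->
  (v x <= n%:E)%E <->
  exists y, (0 <= v y)%E /\ (0 <= v (r ^+ 2 * (q^-1 * x * y - 1))%R)%E.
Proof.
move=> vq vr; have q0 : q != 0.
  by apply/eqP => q0; move: vq; rewrite q0 (valuation0 hv).
split=> [xn|[y [yint yx]]].
  have x0 : x != 0 by apply: contraTneq xn => ->; rewrite (valuation0 hv).
  exists (q / x); split.
    rewrite (valuationM hv) (valuationV hv)// vq.
    by rewrite sube_ge0 ?orbT.
  rewrite mulrACA mulVf// mulfV// mulr1 subrr mulr0.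
  by rewrite (valuation0 hv) leey.
set u := q^-1 * x * y in yx.
have u1 : (0 < v (u - 1)%R)%E.
  move: yx; rewrite expr2 !(valuationM hv) vr -EFinD.
  case: (v (u - 1)) => [z||] //=; rewrite ?ltry//.
  by rewrite -EFinD lee_fin lte_fin; lia.
have vu : v u = 0%E.
  apply/eqP; rewrite eq_le; apply/andP; split.
    rewrite leNgt; apply/negP => u_pos.
    have := valuationD hv u (- (u - 1)).
    rewrite (valuationN hv) subKr (valuation1 hv).
    by rewrite leNgt lt_min u_pos u1.
  rewrite -[u](subrK 1); apply: (integralD hv); first exact: ltW.
  by rewrite (valuation1 hv).
move: vu yint; rewrite /u !(valuationM hv) (valuationV hv)// vq.
case: (v x) (@valuation_neqNy _ _ _ hv x) => [z||] //= _;
  case: (v y) => [t||] //=.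
by rewrite -!EFinD => -[]; rewrite !lee_fin; lia.
Qed.

Lemma semidefinite_representable_line1 (d : nat) (A0 A1 B : 'M[K]_d)
    (S : set K) :
  (forall x, S x <-> exists y, psdmx iota w (A0 + x *: A1 + y *: B)) ->
  semidefinite_representable iota w (line_set S).
Proof.
move=> SE; exists 1%N, d, A0, (fun=> A1), (fun=> B).
apply/seteqP; split=> x /=; rewrite big_ord1 /line_set /= SE => -[y psd].
  by exists (const_mx y); rewrite big_ord1 mxE.
by exists (y 0 0); rewrite big_ord1 in psd.
Qed.

Lemma annulus_semidefinite_representable (A : set K) :
  (forall z : \bar int, z <> -oo%E -> exists x, v x = z) ->
  is_annulus R v A -> semidefinite_representable iota w (line_set A).
Proof.
move=> vsurj /annulusE[m [n AE]].
have fin_value z : exists x, v x = z%:E by exact: vsurj.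
have [p vp] := fin_value m; have [q vq] := fin_value n.
have [r vr] := fin_value (- 1).
have p0 : p != 0 by apply/eqP => p0; move: vp; rewrite p0 (valuation0 hv).
(* Row by row, the pencil [N0 + x *: N1 + y *: N2] is
   [r, - r^2 x / q] and [y, - r]. *)
pose N0 : 'M[K]_2 := r *: delta_mx 0 0 - r *: delta_mx 1 1.
pose N1 : 'M[K]_2 := (- (r ^+ 2 / q)) *: delta_mx 0 1.
pose N2 : 'M[K]_2 := delta_mx 1 0.
have NE x y : psdmx iota w (N0 + x *: N1 + y *: N2) <->
    (0 <= v (r ^+ 2 * (q^-1 * x * y - 1))%R)%E.
  have trN : \tr (N0 + x *: N1 + y *: N2) = 0.
    by rewrite /mxtrace !big_ord_recl big_ord0 !mxE /=; ring.
  have detN : \det (N0 + x *: N1 + y *: N2) = r ^+ 2 * (q^-1 * x * y - 1).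
    rewrite (expand_det_row _ 0) !big_ord_recl big_ord0 /cofactor !det_mx11.
    by rewrite !mxE /=; ring.
  rewrite (psdmx2 hv hw) trN detN (valuation0 hv).
  by split=> [[]|].
apply: (@semidefinite_representable_line1 _
  (block_mx 0 0 0 (block_mx 0 0 0 N0) : 'M_(1 + (1 + 2)))
  (block_mx p^-1%:M 0 0 (block_mx 0 0 0 N1))
  (block_mx 0 0 0 (block_mx 1%:M 0 0 N2))) => x.
rewrite AE.
have pencilE y : psdmx iota w
    (block_mx 0 0 0 (block_mx 0 0 0 N0) +
     x *: block_mx p^-1%:M 0 0 (block_mx 0 0 0 N1) +
     y *: block_mx 0 0 0 (block_mx 1%:M 0 0 N2) : 'M_(1 + (1 + 2))) <->
    (m%:E <= v x)%E /\
    (0 <= v y)%E /\ (0 <= v (r ^+ 2 * (q^-1 * x * y - 1))%R)%E.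
  rewrite !scale_block_mx !add_block_mx !scaler0 !addr0 !add0r.
  rewrite !psdmx_block_diag NE !scale_scalar_mx !(psdmx_scalar1 hv hw) mulr1.
  by rewrite (valuationM hv) (valuationV hv)// vp sube_ge0// orbT.
split=> [/andP[mx /(valuation_le_lift _ vq vr)[y yP]]|[y]].
  by exists y; apply/pencilE.
move=> /pencilE[-> yP]; apply/(valuation_le_lift _ vq vr).
by exists y.
Qed.

(** An annulus is stable under multiplication by units, so a spectrahedron equal
    to it contains all unit multiples of one of its points. Its pencil condition
    and its affine subspace then both extend to the origin, which is not in the
    annulus. *)
Lemma annulus_not_spectrahedron (A : set K) :
  infinite_set (residue_field v) ->
  is_annulus R v A -> A !=set0 -> ~ spectrahedron iota w (line_set A).
Proof.
move=> res_inf /annulusE[m [n AE]] [x0 Ax0] [d [A0 [A1 [E [[p [U EE]] SE]]]]].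
have Aunit t : v t = 0%E -> A (t * x0).
  by move=> vt; rewrite AE (valuationM hv) vt add0e -AE.
have inS t : v t = 0%E -> line_set A (t *: const_mx x0).
  by move=> /Aunit; rewrite /line_set /= !mxE.
suff : line_set A 0.
  by rewrite /line_set /= mxE AE (valuation0 hv) => /andP[].
rewrite SE; split.
  rewrite /= big_ord1 mxE scale0r addr0.
  apply: (@psdmx_pencil0 _ _ (x0 *: A1 0)) => // t /inS.
  rewrite SE => -[psd _]; move: psd.
  by rewrite /= big_ord1 !mxE scalerA => psd; exact: psd.
(* Differences of points of the affine subspace lie in its direction [U]; the
   two points [t *: x0] and [t' *: x0] span the line through the origin. *)
have [s] := exists_units_distinct_residues hv res_inf 2.
case: s => [|t [|t' []]] //= _ [s_unit]; rewrite !andbT => /eqP tt'.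
have t't : t' - t != 0.
  by apply/eqP => t0; move: tt'; rewrite t0 (valuation0 hv).
have inE u : u \in [:: t; t'] -> u *: const_mx x0 - p \in U.
  by move=> /s_unit/inS; rewrite SE EE => -[].
have Et : t *: const_mx x0 - p \in U by apply: inE; rewrite mem_head.
have Et' : t' *: const_mx x0 - p \in U.
  by apply: inE; rewrite !in_cons eqxx orbT.
rewrite EE /=.
have -> : 0 - p = (t *: const_mx x0 - p)
    - (t / (t' - t)) *: ((t' *: const_mx x0 - p) - (t *: const_mx x0 - p)).
  rewrite [- (_ *: _ - p)]opprB addrA subrK -scalerBl scalerA divfK//.
  by rewrite addrAC subrr.
by apply: memvB => //; apply/memvZ/memvB.
Qed.

End Annulus.

Theorem theorem1p2 (R : realType) (K : fieldType) (v : K -> \bar int)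
  (hv : complete_discretely_valued R v)
  (L : closedFieldType) (iota : {rmorphism K -> L})
  (hL : is_algebraic_closure iota)
  (w : L -> \bar R) (hw : extends_valuation v iota w) :
  (forall A : set K, is_annulus R v A ->
     semidefinite_representable iota w (line_set A)) /\
  (infinite_set (residue_field v) ->
     forall A : set K, is_annulus R v A -> A !=set0 ->
       ~ spectrahedron iota w (line_set A)).
Proof.
have hval := cdv_valuation hv; split=> [A|res_inf A].
  exact: (annulus_semidefinite_representable hval hw (cdv_surjective hv)).
exact: (annulus_not_spectrahedron hval hw).
Qed.
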